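(* Let $n\in\mathbb N$, $\Theta\in\mathbb R^{n\times n}$, $\tau>0$, and let $F_\tau:\mathbb R^{n\times n}\to\mathbb R\cup\{+\infty\}$ be proper, lower semicontinuous and convex. Put $G_\tau=F_\tau+\delta_{\mathbb R_+^{n\times n}}$ and assume that the conjugate $G_\tau^*$ is finite everywhere, continuously differentiable and strictly convex on $\mathbb R^{n\times n}$. Let $$g(\mu,\nu)=\langle\mu,\nu\rangle-G_\tau^*(\mathcal A^\top\nu-\Theta),\qquad \mu,\nu\in\mathbb R^{2n},$$ and assume that strong duality holds at every $p=(p_1,p_2)\in\mathcal S\times\mathcal S$, i.e. $d_{\Theta,\tau}(p_1,p_2)$ is finite, the maximum of $g(p,\cdot)$ over $\mathbb R^{2n}$ is attained, and $d_{\Theta,\tau}(p_1,p_2)=\max_{\nu\in\mathbb R^{2n}}g(p,\nu)$. Then the smoothed Wasserstein distance $d_{\Theta,\tau}:\mathcal S\times\mathcal S\to\mathbb R$ is differentiable, and its Euclidean gradient at $p=(p_1,p_2)\in\mathcal S\times\mathcal S$ is $$\nabla d_{\Theta,\tau}(p_1,p_2)=P_{T\times T}(\overline\nu)=\begin{pmatrix}P_T(\overline\nu_1)\\ P_T(\overline\nu_2)\end{pmatrix},$$ where $\overline\nu=(\overline\nu_1,\overline\nu_2)$ is any element of $\arg\max_{\nu\in\mathbb R^{2n}}g(p,\nu)$.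
   Context: $\mathbf 1_n=(1,\dots,1)^\top\in\mathbb R^n$. $\Delta_n=\{q\in\mathbb R^n: q\ge 0,\ \langle\mathbf 1_n,q\rangle=1\}$ is the probability simplex. $\mathcal S=\{q\in\mathbb R^n: q_i>0\ \forall i,\ \langle\mathbf 1_n,q\rangle=1\}$ is its relative interior, regarded as a Euclidean submanifold of $\mathbb R^n$ with constant tangent space $T=\{v\in\mathbb R^n:\langle\mathbf 1_n,v\rangle=0\}$. $P_T(x)=x-\frac1n\langle\mathbf 1_n,x\rangle\mathbf 1_n$ is the orthogonal projection onto $T$, and $P_{T\times T}$ applies $P_T$ to each of the two blocks of a vector in $\mathbb R^{2n}=\mathbb R^n\times\mathbb R^n$. The Euclidean gradient of a differentiable function $f:\mathcal S\times\mathcal S\to\mathbb R$ at $p$ is the unique $\nabla f(p)\in T\times T$ with $\langle\nabla f(p),v\rangle=Df(p)[v]$ for all $v\in T\times T$. The linear map $\mathcal A:\mathbb R^{n\times n}\to\mathbb R^{2n}$ is $\mathcal A M=\begin{pmatrix}M\mathbf 1_n\\ M^\top\mathbf 1_n\end{pmatrix}$, with transpose $\mathcal A^\top(\nu_1,\nu_2)=\nu_1\mathbf 1_n^\top+\mathbf 1_n\nu_2^\top$. The matrix inner product is $\langle A,B\rangle=\mathrm{tr}(A^\top B)$. For $\mu_1,\mu_2\in\Delta_n$, $\Pi(\mu_1,\mu_2)=\{M\in\mathbb R_+^{n\times n}: M\mathbf 1_n=\mu_1,\ M^\top\mathbf 1_n=\mu_2\}$, and the smoothed Wasserstein distance is $$d_{\Theta,\tau}(\mu_1,\mu_2)=\min_{M\in\Pi(\mu_1,\mu_2)}\{\langle\Theta,M\rangle+F_\tau(M)\}.$$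 $\delta_C$ denotes the indicator function of a set $C$ ($0$ on $C$, $+\infty$ outside), and $G^*(Y)=\sup_{M}\{\langle Y,M\rangle-G(M)\}$ is the Legendre–Fenchel conjugate. *)

(* Defs.v *)
From HB Require Import structures.
From mathcomp Require Import all_boot all_order all_algebra.
From mathcomp Require Import all_classical all_reals all_analysis.
From mathcomp Require Import ring.

Set Implicit Arguments.
Unset Strict Implicit.
Unset Printing Implicit Defensive.
Import Order.TTheory GRing.Theory Num.Theory.
Import numFieldNormedType.Exports.
Local Open Scope classical_set_scope.
Local Open Scope ring_scope.

(* Vectors of R^n are columns 'cV[R]_n and R^(2n) is the product
   'cV[R]_n * 'cV[R]_n, so that the blocks of nu are nu.1 and nu.2. *)

Definition mxdot (R : realType) (m n : nat) (A B : 'M[R]_(m, n)) : R :=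
  \tr (A^T *m B).

Definition pdot (R : realType) (n : nat) (mu nu : 'cV[R]_n * 'cV[R]_n) : R :=
  mxdot mu.1 nu.1 + mxdot mu.2 nu.2.

Definition onev (R : realType) (n : nat) : 'cV[R]_n := const_mx 1.

Definition Amap (R : realType) (n : nat) (M : 'M[R]_n) :
  'cV[R]_n * 'cV[R]_n := (M *m onev R n, M^T *m onev R n).

Definition Atr (R : realType) (n : nat) (nu : 'cV[R]_n * 'cV[R]_n) : 'M[R]_n :=
  nu.1 *m (onev R n)^T + onev R n *m nu.2^T.

Lemma mxdot_Atr (R : realType) (n : nat) (nu : 'cV[R]_n * 'cV[R]_n)
    (M : 'M[R]_n) :
  mxdot (Atr nu) M = pdot nu (Amap M).
Proof.
rewrite /pdot /mxdot /Atr /Amap /= linearD /= mulmxDl raddfD /=; congr (_ + _).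
  by rewrite trmx_mul trmxK -mulmxA mxtrace_mulC mulmxA.
rewrite trmx_mul trmxK -mxtrace_tr !trmx_mul !trmxK.
by rewrite mulmxA mxtrace_mulC mulmxA.
Qed.

Definition simplex_int (R : realType) (n : nat) : set 'cV[R]_n :=
  [set q : 'cV[R]_n | (forall i, 0 < q i 0) /\ mxdot (onev R n) q = 1].

Definition tangent (R : realType) (n : nat) : set 'cV[R]_n :=
  [set v : 'cV[R]_n | mxdot (onev R n) v = 0].

Definition PT (R : realType) (n : nat) (x : 'cV[R]_n) : 'cV[R]_n :=
  x - (n%:R^-1 * mxdot (onev R n) x) *: onev R n.

Definition PTT (R : realType) (n : nat) (nu : 'cV[R]_n * 'cV[R]_n) :
  'cV[R]_n * 'cV[R]_n := (PT nu.1, PT nu.2).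

(* Only the values of f on S x S matter: the increment q - p runs through
   elements of T x T, on which L is the differential Df(p).  The norm is the
   sup norm of the library, equivalent to the Euclidean one. *)
Definition has_differential (R : realType) (n : nat)
    (f : 'cV[R]_n * 'cV[R]_n -> R) (p : 'cV[R]_n * 'cV[R]_n)
    (L : {linear ('cV[R]_n * 'cV[R]_n)%type -> R^o}) : Prop :=
  forall e : R, 0 < e ->
    \forall q \near within (@simplex_int R n `*` @simplex_int R n) (nbhs p),
      `|f q - f p - L (q - p)| <= e * `|q - p|.

Definition differentiable_on_SS (R : realType) (n : nat)
    (f : 'cV[R]_n * 'cV[R]_n -> R) : Prop :=
  forall p, (@simplex_int R n `*` @simplex_int R n) p ->
    exists L, has_differential f p L.

Definition is_gradient (R : realType) (n : nat)
    (f : 'cV[R]_n * 'cV[R]_n -> R) (p w : 'cV[R]_n * 'cV[R]_n) : Prop :=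
  (@tangent R n `*` @tangent R n) w /\
  exists L, has_differential f p L /\
    forall v, (@tangent R n `*` @tangent R n) v -> pdot w v = L v.

Definition gradient (R : realType) (n : nat)
    (f : 'cV[R]_n * 'cV[R]_n -> R) (p : 'cV[R]_n * 'cV[R]_n) :
  'cV[R]_n * 'cV[R]_n := get (is_gradient f p).

Definition proper_fun (R : realType) (E : Type) (F : E -> \bar R) : Prop :=
  (forall x, F x != -oo%E) /\ exists x, F x != +oo%E.

Definition convex_ereal (R : realType) (E : lmodType R) (F : E -> \bar R) :
  Prop :=
  forall (x y : E) (t : R), 0 < t < 1 ->
    (F (t *: x + (1 - t) *: y)%R <= t%:E * F x + (1 - t)%:E * F y)%E.

Definition strictly_convex (R : realType) (E : lmodType R) (f : E -> R) :
  Prop :=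
  forall (x y : E) (t : R), x != y -> 0 < t < 1 ->
    f (t *: x + (1 - t) *: y) < t * f x + (1 - t) * f y.

(* The matrix of partial derivatives of f at Y; its continuity is that of the
   differential Y |-> Df(Y). *)
Definition mxgrad (R : realType) (m n : nat) (f : 'M[R]_(m, n) -> R)
    (Y : 'M[R]_(m, n)) : 'M[R]_(m, n) :=
  \matrix_(i, j) 'd f Y (delta_mx i j).

Definition continuously_differentiable (R : realType) (m n : nat)
    (f : 'M[R]_(m, n) -> R) : Prop :=
  (forall Y, differentiable f Y) /\ continuous (mxgrad f).

Definition nonneg_mx (R : realType) (m n : nat) : set 'M[R]_(m, n) :=
  [set M : 'M[R]_(m, n) | forall i j, 0 <= M i j].

Definition indicator (R : realType) (E : Type) (C : set E) (x : E) : \bar R :=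
  if `[< C x >] then 0%E else +oo%E.

Definition conjugate (R : realType) (m n : nat) (G : 'M[R]_(m, n) -> \bar R)
    (Y : 'M[R]_(m, n)) : \bar R :=
  ereal_sup [set ((mxdot Y M)%:E - G M)%E | M in setT].

Definition couplings (R : realType) (n : nat) (mu : 'cV[R]_n * 'cV[R]_n) :
  set 'M[R]_n := [set M : 'M[R]_n | nonneg_mx M /\ Amap M = mu].

(* The infimum is a minimum when it is finite: F is lower semicontinuous and
   the set of couplings is compact. *)
Definition smoothed_wasserstein (R : realType) (n : nat) (Theta : 'M[R]_n)
    (F : 'M[R]_n -> \bar R) (mu : 'cV[R]_n * 'cV[R]_n) : \bar R :=
  ereal_inf [set ((mxdot Theta M)%:E + F M)%E | M in couplings mu].

Definition restrict_nonneg (R : realType) (n : nat) (F : 'M[R]_n -> \bar R)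
    (M : 'M[R]_n) : \bar R :=
  (F M + indicator R (@nonneg_mx R n n) M)%E.

Definition dual_obj (R : realType) (n : nat) (Theta : 'M[R]_n)
    (F : 'M[R]_n -> \bar R) (mu nu : 'cV[R]_n * 'cV[R]_n) : \bar R :=
  ((pdot mu nu)%:E - conjugate (restrict_nonneg F) (Atr nu - Theta)%R)%E.

Definition is_argmax (R : realType) (E : Type) (h : E -> \bar R) (x : E) :
  Prop := forall y, (h y <= h x)%E.

Definition strong_duality (R : realType) (n : nat) (Theta : 'M[R]_n)
    (F : 'M[R]_n -> \bar R) (p : 'cV[R]_n * 'cV[R]_n) : Prop :=
  smoothed_wasserstein Theta F p \is a fin_num /\
  exists2 nu, is_argmax (dual_obj Theta F p) nu &
    smoothed_wasserstein Theta F p = dual_obj Theta F p nu.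

Section gradient_unique.
Variables (R : realType) (n : nat).
Implicit Types (u v w p : 'cV[R]_n * 'cV[R]_n) (x y : 'cV[R]_n).

Lemma mxdotE x y : mxdot x y = \sum_i x i 0 * y i 0.
Proof.
rewrite /mxdot /mxtrace big_ord1 mxE; apply: eq_bigr => i _.
by rewrite mxE.
Qed.

Lemma mxdotDr x y z : mxdot x (y + z) = mxdot x y + mxdot x z.
Proof. by rewrite /mxdot mulmxDr raddfD. Qed.

Lemma mxdotZr x a y : mxdot x (a *: y) = a * mxdot x y.
Proof. by rewrite /mxdot -scalemxAr linearZ. Qed.

Lemma mxdotC x y : mxdot x y = mxdot y x.
Proof. by rewrite !mxdotE; apply: eq_bigr => i _; rewrite mulrC. Qed.

Lemma mxdot_ge0 x : 0 <= mxdot x x.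
Proof. by rewrite mxdotE; apply: sumr_ge0 => i _; rewrite -expr2 sqr_ge0. Qed.

Lemma mxdot_eq0 x : mxdot x x = 0 -> x = 0.
Proof.
rewrite mxdotE => /eqP; rewrite psumr_eq0; last first.
  by move=> i _; rewrite -expr2 sqr_ge0.
move=> /allP h; apply/matrixP => i j; rewrite (ord1 j) [RHS]mxE.
by have := h i (mem_index_enum i); rewrite /= mulf_eq0 orbb => /eqP.
Qed.

Lemma simplex_int_near x y : simplex_int x -> tangent y ->
  \forall t \near (0 : R)^'+, simplex_int (x + t *: y).
Proof.
move=> [x0 x1] y0.
have : \forall t \near (0 : R)^'+, forall i : 'I_n, 0 < (x + t *: y) i 0.
  apply: filter_forall => i.
  near=> t.
  rewrite !mxE -(opprK (t * _)) subr_gt0 -mulrN.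
  have t0 : 0 < t by [].
  rewrite (le_lt_trans (ler_norm _)) // normrM normrN gtr0_norm //.
  rewrite (@le_lt_trans _ _ (t * (`|y i 0| + 1))) //.
    by rewrite ler_pM2l // lerDl.
  rewrite -ltr_pdivlMr ?ltr_wpDl //.
  near: t; apply: nbhs_right_lt.
  by rewrite divr_gt0 // ltr_wpDl.
apply: filterS => t ht; split => //.
by rewrite mxdotDr mxdotZr x1 (y0 : mxdot _ _ = 0) mulr0 addr0.
Unshelve. all: by end_near. Qed.

Lemma is_gradient_unique (f : 'cV[R]_n * 'cV[R]_n -> R) p w w' :
  (@simplex_int R n `*` @simplex_int R n) p ->
  is_gradient f p w -> is_gradient f p w' -> w = w'.
Proof.
move=> [S1 S2] [[T1 T2] [L [hL wL]]] [[T1' T2'] [L' [hL' wL']]].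
pose u := w - w'.
have tanB x y : tangent x -> tangent y -> tangent (x - y).
  move=> hx hy; rewrite /tangent /= -scaleN1r mxdotDr mxdotZr.
  by rewrite (hx : mxdot _ _ = 0) (hy : mxdot _ _ = 0) mulr0 addr0.
have Tu : (@tangent R n `*` @tangent R n) u by split; exact: tanB.
have uL : pdot u u = L u - L' u.
  rewrite -wL // -wL' // /pdot !(mxdotC _ u.1) !(mxdotC _ u.2).
  rewrite /u /= -!(scaleN1r w'.1) -!(scaleN1r w'.2) !mxdotDr !mxdotZr.
  by ring.
have key e : 0 < e -> `|L u - L' u| <= 2 * e * `|u|.
  move=> e0.
  have cvu : (fun t : R => p + t *: u) @ 0^'+ --> p.
    rewrite -[X in _ --> X]addr0 -[in X in _ --> X](scale0r u).
    apply: cvgD; first exact: cvg_cst.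
    apply: cvgZr_tmp; exact: cvg_at_right_filter.
  have H : \forall t \near (0 : R)^'+,
      (@simplex_int R n `*` @simplex_int R n) (p + t *: u) ->
      `|f (p + t *: u) - f p - L (p + t *: u - p)| <= e * `|p + t *: u - p|.
    exact: (cvu _ (hL _ e0)).
  have H' : \forall t \near (0 : R)^'+,
      (@simplex_int R n `*` @simplex_int R n) (p + t *: u) ->
      `|f (p + t *: u) - f p - L' (p + t *: u - p)| <= e * `|p + t *: u - p|.
    exact: (cvu _ (hL' _ e0)).
  near (0 : R)^'+ => t.
  have t0 : 0 < t by [].
  have St : (@simplex_int R n `*` @simplex_int R n) (p + t *: u).
    by split; near: t; apply: simplex_int_near => //; case: Tu.
  have h : `|f (p + t *: u) - f p - L (p + t *: u - p)| <=
      e * `|p + t *: u - p| by move: St; near: t.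
  have h' : `|f (p + t *: u) - f p - L' (p + t *: u - p)| <=
      e * `|p + t *: u - p| by move: St; near: t.
  have E : p + t *: u - p = t *: u by rewrite addrAC subrr add0r.
  move: h h'; rewrite E !linearZ /= normrZ gtr0_norm //.
  set a := f _ - f p => h h'.
  rewrite -(ler_pM2l t0) -[X in X * `|_|]gtr0_norm // -normrM.
  have -> : t * (L u - L' u) = (a - t * L' u) - (a - t * L u) by ring.
  apply: le_trans (ler_normB _ _) _.
  have -> : t * (2 * e * `|u|) = e * (t * `|u|) + e * (t * `|u|) by ring.
  by apply: lerD; [move: h' | move: h]; rewrite scalerN.
have u0 : pdot u u = 0.
  rewrite uL; apply/eqP; rewrite -normr_le0; apply/ler_addgt0Pl => e e0.
  rewrite addr0; have := key (e / (2 * (`|u| + 1))).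
  have k0 : 0 < `|u| + 1 by rewrite ltr_wpDl.
  move=> /(_ (divr_gt0 e0 (mulr_gt0 _ k0)))/le_trans; apply=> //.
  have -> : 2 * (e / (2 * (`|u| + 1))) * `|u| = e * (`|u| / (`|u| + 1)).
    by field; rewrite gt_eqF.
  by rewrite ler_piMr ?ltW// ltr_pdivrMr// mul1r ltrDl.
have /andP[/eqP u1 /eqP u2] : (mxdot u.1 u.1 == 0) && (mxdot u.2 u.2 == 0).
  by rewrite -paddr_eq0 ?mxdot_ge0//; exact/eqP.
apply/eqP; rewrite -subr_eq0 -/u; apply/eqP.
by case: u u1 u2 {Tu uL key u0} => a b /= /mxdot_eq0-> /mxdot_eq0->.
Unshelve. all: by end_near. Qed.

Lemma gradientE (f : 'cV[R]_n * 'cV[R]_n -> R) p w :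
  (@simplex_int R n `*` @simplex_int R n) p ->
  is_gradient f p w -> gradient f p = w.
Proof.
by move=> Sp fw; exact: (is_gradient_unique Sp (getI fw) fw).
Qed.

End gradient_unique.

(* Main.v *)
(* Let H = G_tau^* and let nu, nu_q be maximizers of the dual objective at p and
   q.  Comparing values gives
     <q - p, nu> <= d(q) - d(p) <= <q - p, nu_q>,
   so it suffices that nu_q -> nu as q -> p, modulo the kernel of A^T, which
   is spanned by (1, -1) and orthogonal to q - p.  On the complement
   {<1, nu_1> = 0} of this kernel nu |-> H(A^T nu - Theta) - <p, nu> is strictly
   convex, hence exceeds its minimum by a positive amount on each sphere
   around nu; after a small linear perturbation the values on the sphere are
   still above the value at nu, and by convexity every minimizer stays in the
   ball. *)

Require Import Defs.
From HB Require Import structures.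
From mathcomp Require Import all_boot all_order all_algebra.
From mathcomp Require Import all_classical all_reals all_analysis.
From mathcomp Require Import ring lra.

Set Implicit Arguments.
Unset Strict Implicit.
Unset Printing Implicit Defensive.
Import Order.TTheory GRing.Theory Num.Theory.
Import numFieldNormedType.Exports.
Local Open Scope classical_set_scope.
Local Open Scope ring_scope.

(** * Stability of constrained minimizers under small linear perturbations *)

Lemma argmin_stable (R : realType) (V : normedModType R) (W : set V)
    (psi : V -> R) (x0 : V) (e : R) :
  0 < e -> W x0 ->
  (forall x y (t : R), W x -> W y -> W (t *: x + (1 - t) *: y)) ->
  compact (W `&` [set x | `|x - x0| = e]) -> continuous psi ->
  (forall x y (t : R), W x -> W y -> x != y -> 0 < t < 1 ->
    psi (t *: x + (1 - t) *: y) < t * psi x + (1 - t) * psi y) ->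
  (forall x, W x -> psi x0 <= psi x) ->
  exists2 d : R, 0 < d &
    forall (l : {linear V -> R^o}) (y : V), (forall x, `|l x| <= d * `|x|) ->
      W y -> psi y - l y <= psi x0 - l x0 -> `|y - x0| < e.
Proof.
move=> e0 Wx0 Wconv Scpt psic psiconv x0min.
set S := W `&` _ in Scpt.
(* The gap [d] is the minimum of [psi] over the compact slice [S] minus [psi x0]; if [S] is empty,
   any positive number serves. *)
have [d d0 dS] : exists2 d : R, 0 < d & forall x, S x -> psi x0 + d <= psi x.
  have [S0|/set0P/negP/negPn/eqP S0] := pselect (S !=set0); last first.
    by exists 1 => // x; rewrite S0.
  have [c /set_mem Sc cmin] : exists2 c, c \in S &
      forall t, t \in S -> psi c <= psi t.
    by apply: compact_EVT_min => //; exact: continuous_subspaceT.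
  exists (psi c - psi x0); last first.
    by move=> x /mem_set Sx; rewrite addrC subrK cmin.
  have [Wc ce] := Sc.
  have cx0 : c != x0.
    apply/eqP => cE; move: ce; rewrite cE /= subrr normr0 => e00.
    by rewrite -e00 ltxx in e0.
  (* At the midpoint of [c] and [x0], [psi] is at least [psi x0] but strictly below the average of
     the two values, so [psi c > psi x0]. *)
  have t01 : 0 < (2^-1 : R) < 1 by rewrite invr_gt0 invf_lt1 ?ltr0n ?ltr1n.
  have := psiconv c x0 2^-1 Wc Wx0 cx0 t01.
  have := x0min _ (Wconv c x0 2^-1 Wc Wx0).
  lra.
(* On the sphere of radius [e] such an [l] deviates from [l x0] by at most [d / 2], half the gap. *)
exists (d / (2 * e)); first by rewrite divr_gt0 // mulr_gt0.
move=> l y lb Wy ymin; rewrite ltNge; apply/negP => ey.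
have r0 : 0 < `|y - x0| by exact: lt_le_trans ey.
have yx0 : y != x0 by rewrite -subr_eq0 -normr_gt0.
(* A [y] outside the open ball is pulled back along the segment to [x0] until it meets the sphere,
   at [x]. *)
pose t := e / `|y - x0|.
have t0 : 0 < t by rewrite divr_gt0.
have t1 : t <= 1 by rewrite ler_pdivrMr // mul1r.
pose x := t *: y + (1 - t) *: x0.
have xx0 : x - x0 = t *: (y - x0).
  by rewrite /x scalerBl scale1r scalerBr addrA addrAC addrK.
have xe : `|x - x0| = e by rewrite xx0 normrZ gtr0_norm // divfK // gt_eqF.
have Sx : S x by split => //; exact: Wconv.
have psix : psi x <= t * psi y + (1 - t) * psi x0.
  move: t1; rewrite le_eqVlt => /predU1P[tE|t1].
    by rewrite /x tE subrr scale0r addr0 mul0r addr0 scale1r mul1r.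
  by apply/ltW/psiconv => //; rewrite t0.
have lx : l (x - x0) = t * (l y - l x0) by rewrite xx0 linearZ linearB.
have : `|l (x - x0)| <= d / 2.
  by rewrite (le_trans (lb _)) // xe invfM mulrA mulfVK ?gt_eqF.
rewrite ler_norml => /andP[_]; rewrite lx => ld.
(* With these bounds, [d <= psi x - psi x0 <= t * (psi y - psi x0) <= l (x - x0) <= d / 2], a
   contradiction. *)
have := dS x Sx.
have : t * (psi y - l y) <= t * (psi x0 - l x0) by rewrite ler_pM2l.
lra.
Qed.

Lemma linear_le_continuous (R : realType) (U V : normedModType R)
    (f : {linear U -> V}) (c : R) :
  (forall x, `|f x| <= c * `|x|) -> continuous f.
Proof.
move=> fc; apply/bounded_linear_continuous/linear_boundedP; near=> r => x.
by rewrite (le_trans (fc x)) // ler_wpM2r.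
Unshelve. all: by end_near. Qed.

(** * The pairing on R^n x R^n, compactness of spheres, and the kernel of [Atr] *)

Section pairing.
Variables (R : realType) (n : nat).
Local Notation V := ('cV[R]_n * 'cV[R]_n)%type.
Implicit Types (u v w p q : V) (x y : 'cV[R]_n).

Lemma mxdotNr x y : mxdot x (- y) = - mxdot x y.
Proof. by rewrite -scaleN1r mxdotZr mulN1r. Qed.

Lemma mxdot_onev x : mxdot (onev R n) x = \sum_i x i 0.
Proof. by rewrite mxdotE; apply: eq_bigr => i _; rewrite mxE mul1r. Qed.

Lemma mxdot_onev_onev : mxdot (onev R n) (onev R n) = n%:R.
Proof.
rewrite mxdot_onev (eq_bigr (fun=> 1)) ?sumr_const ?card_ord // => i _.
by rewrite mxE.
Qed.

Lemma pdotC u v : pdot u v = pdot v u.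
Proof. by rewrite /pdot !(mxdotC u.1) !(mxdotC u.2). Qed.

Lemma pdot_is_linear w : linear (pdot w : V -> R^o).
Proof.
move=> a u v; rewrite /pdot /= !mxdotDr !mxdotZr.
by rewrite /GRing.scale /=; ring.
Qed.

HB.instance Definition _ w :=
  GRing.isLinear.Build R V R^o _ (pdot w : V -> R^o) (pdot_is_linear w).

Lemma pdotDr w u v : pdot w (u + v) = pdot w u + pdot w v.
Proof. exact: (linearD (pdot w : V -> R^o)). Qed.

Lemma pdotBr w u v : pdot w (u - v) = pdot w u - pdot w v.
Proof. exact: (linearB (pdot w : V -> R^o)). Qed.

Lemma pdotZr w (a : R) u : pdot w (a *: u) = a * pdot w u.
Proof. by rewrite /pdot /= !mxdotZr mulrDr. Qed.

Lemma pdotBl u v w : pdot (u - v) w = pdot u w - pdot v w.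
Proof. by rewrite !(pdotC _ w) pdotBr. Qed.

Lemma ler_norm_coord m k (A : 'M[R]_(m, k)) i j : `|A i j| <= `|A|.
Proof.
rewrite [leRHS]mx_normrE.
exact: (le_bigmax _ (fun ij : 'I_m * 'I_k => `|A ij.1 ij.2|) (i, j)).
Qed.

Lemma ler_mx_norm m k (A : 'M[R]_(m, k)) (r : R) :
  0 <= r -> (forall i j, `|A i j| <= r) -> `|A| <= r.
Proof.
move=> r0 Ar; rewrite [leLHS]mx_normrE.
by apply/bigmax_leP; split => // -[i j] _; exact: Ar.
Qed.

Lemma norm_fst_le u : `|u.1| <= `|u|.
Proof. by rewrite prod_normE /= le_max lexx. Qed.

Lemma norm_snd_le u : `|u.2| <= `|u|.
Proof. by rewrite prod_normE /= le_max lexx orbT. Qed.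

(** The norms are sup norms, so each of the n products is bounded separately; hence the factor n.
    The two blocks double it in [norm_pdot]. *)
Lemma norm_mxdot x y : `|mxdot x y| <= n%:R * `|x| * `|y|.
Proof.
rewrite mxdotE (le_trans (ler_norm_sum _ _ _)) //.
rewrite -mulrA mulr_natl -[X in _ *+ X]card_ord -sumr_const.
by apply: ler_sum => i _; rewrite normrM ler_pM // ler_norm_coord.
Qed.

Lemma norm_pdot u v : `|pdot u v| <= (n%:R * 2) * `|u| * `|v|.
Proof.
rewrite (le_trans (ler_normD _ _)) //.
have -> : n%:R * 2 * `|u| * `|v| =
  n%:R * `|u| * `|v| + n%:R * `|u| * `|v| :> R by ring.
by apply: lerD; rewrite (le_trans (norm_mxdot _ _)) // -!mulrA ler_wpM2l //
  ler_pM // ?norm_fst_le ?norm_snd_le.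
Qed.

Lemma pdot_continuous w : continuous (pdot w).
Proof.
by apply: (@linear_le_continuous _ _ _ (pdot w : V -> R^o)
  (n%:R * 2 * `|w|)) => u; exact: norm_pdot.
Qed.

Lemma AtrE u i j : Atr u i j = u.1 i 0 + u.2 j 0.
Proof. by rewrite !mxE !big_ord1 !mxE mulr1 mul1r. Qed.

Lemma Atr_is_linear : linear (@Atr R n).
Proof.
by move=> a u v; apply/matrixP => i j; rewrite !(AtrE, mxE) /=; ring.
Qed.

HB.instance Definition _ :=
  GRing.isLinear.Build R V 'M[R]_n _ (@Atr R n) Atr_is_linear.

Lemma Atr_continuous : continuous (@Atr R n).
Proof.
apply: (@linear_le_continuous _ _ _ (@Atr R n) 2) => u.
apply: ler_mx_norm => [|i j]; first by rewrite mulr_ge0.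
rewrite AtrE (le_trans (ler_normD _ _)) // mulr_natl mulr2n.
apply: lerD; first exact: le_trans (ler_norm_coord _ _ _) (norm_fst_le _).
exact: le_trans (ler_norm_coord _ _ _) (norm_snd_le _).
Qed.

(** Heine-Borel for row vectors, carried to columns by transposition, which preserves the sup
    norm. *)
Lemma compact_ball_cV (r : R) : compact [set x : 'cV[R]_n | `|x| <= r].
Proof.
have trc : continuous (trmx : 'rV[R]_n -> 'cV[R]_n).
  apply: (@linear_le_continuous _ _ _ (trmx : 'rV[R]_n -> 'cV[R]_n) 1) => x.
  rewrite mul1r; apply: ler_mx_norm => // i j.
  by rewrite mxE ler_norm_coord.
have : compact (trmx @` [set x : 'rV[R]_n | `|x| <= r]).
  apply: continuous_compact; first exact: continuous_subspaceT.
  apply: bounded_closed_compact; last first.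
    by apply: preimage_closed (@closed_le _ r) => x _; exact: norm_continuous.
  exists r; split; first exact: num_real.
  by move=> s rs x /= /le_trans; apply; exact: ltW.
move=> ballc; apply: subclosed_compact ballc _.
  by apply: preimage_closed (@closed_le _ r) => x _; exact: norm_continuous.
move=> x /= xr; exists x^T; last exact: trmxK.
rewrite /= (le_trans _ xr) //; apply: ler_mx_norm => // i j.
by rewrite mxE ler_norm_coord.
Qed.

Lemma closed_sphere u (r : R) : closed [set v : V | `|v - u| = r].
Proof.
have vc : continuous (fun v : V => `|v - u|).
  by move=> v; apply: cvg_norm; apply: cvgB => //; exact: cvg_cst.
by apply: preimage_closed (@closed_eq _ r) => v _; exact: vc.
Qed.

Lemma compact_sphere u (r : R) : compact [set v : V | `|v - u| = r].
Proof.
have ballc := compact_setX (@compact_ball_cV (r + `|u|))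
  (@compact_ball_cV (r + `|u|)).
apply: subclosed_compact ballc _; first exact: closed_sphere.
move=> v /= vr.
have vu : `|v| <= r + `|u| by rewrite -vr -{1}(subrK u v) ler_normD.
by split; rewrite /= (le_trans _ vu) // ?norm_fst_le ?norm_snd_le.
Qed.

Lemma closed_tangent_fst : closed [set u : V | tangent u.1].
Proof.
pose w : V := (onev R n, 0).
have -> : [set u : V | tangent u.1] = pdot w @^-1` [set 0].
  have wE u : pdot w u = mxdot (onev R n) u.1.
    by rewrite /pdot /= (mxdotC 0) -(scale0r 0) mxdotZr mul0r addr0.
  by apply/seteqP; split => u; rewrite /tangent /= wE.
by apply: preimage_closed (@closed_eq _ 0) => u _; exact: pdot_continuous.
Qed.

(* Translating by a multiple of (1, -1), which spans the kernel of Atr. *)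
Definition mass_balance u : V :=
  (PT u.1, u.2 + (n%:R^-1 * mxdot (onev R n) u.1) *: onev R n).

Lemma Atr_mass_balance u : Atr (mass_balance u) = Atr u.
Proof. by apply/matrixP => i j; rewrite !AtrE /PT /= !mxE; ring. Qed.

(** The blocks of [u] move by opposite multiples of the all-ones vector, and these contributions
    cancel when the blocks of [p] have equal mass. *)
Lemma pdot_mass_balance p u : mxdot (onev R n) p.1 = mxdot (onev R n) p.2 ->
  pdot p (mass_balance u) = pdot p u.
Proof.
move=> p12; rewrite /pdot /PT /= !mxdotDr mxdotNr !mxdotZr.
by rewrite !(mxdotC _ (onev R n)) p12; ring.
Qed.

Hypothesis n_gt0 : (0 < n)%N.

Let n_neq0 : n%:R != 0 :> R. Proof. by rewrite pnatr_eq0 -lt0n. Qed.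

Lemma PT_tangent x : tangent (PT x).
Proof.
rewrite /tangent /PT /= mxdotDr mxdotNr mxdotZr mxdot_onev_onev.
by rewrite mulrAC mulVf // mul1r subrr.
Qed.

(** Summing a column of [Atr u] kills the tangent first block and leaves n times an entry of [u.2];
    the first block then follows by cancellation. *)
Lemma Atr_inj_tangent u v : tangent u.1 -> tangent v.1 ->
  Atr u = Atr v -> u = v.
Proof.
move=> u1 v1 uv.
have E i j : u.1 i 0 + u.2 j 0 = v.1 i 0 + v.2 j 0 by rewrite -!AtrE uv.
have E2 j : u.2 j 0 = v.2 j 0.
  have sumE (a : 'cV[R]_n) (b : R) : tangent a ->
      \sum_i (a i 0 + b) = n%:R * b.
    rewrite /tangent /= mxdot_onev => a0.
    by rewrite big_split /= a0 add0r sumr_const card_ord mulr_natl.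
  apply: (mulfI n_neq0); rewrite -(sumE u.1) // -(sumE v.1) //.
  by apply: eq_bigr => i _; exact: E.
have E1 i : u.1 i 0 = v.1 i 0.
  by apply: (addIr (u.2 i 0)); rewrite E E2.
rewrite (surjective_pairing u) (surjective_pairing v); congr (_, _);
  by apply/matrixP => i j; rewrite (ord1 j).
Qed.

(** [PT x] differs from [x] by a multiple of the all-ones vector, which is orthogonal to T. This
    lets [PTT nu] represent the differential [pdot nu]. *)
Lemma mxdot_PT x y : tangent y -> mxdot (PT x) y = mxdot x y.
Proof.
move=> y0; rewrite !(mxdotC _ y) /PT mxdotDr mxdotNr mxdotZr.
by rewrite (mxdotC y (onev _ _)) (y0 : mxdot _ _ = 0) mulr0 subr0.
Qed.

End pairing.

(** * Differentiability of the value function of a strictly convex dual *)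

Section dual_value.
Variables (R : realType) (n : nat) (Theta : 'M[R]_n) (H : 'M[R]_n -> R).
Variables (f : 'cV[R]_n * 'cV[R]_n -> R).
Local Notation V := ('cV[R]_n * 'cV[R]_n)%type.
Local Notation SS := (@simplex_int R n `*` @simplex_int R n).
Let g (p nu : V) : R := pdot p nu - H (Atr nu - Theta).
Hypothesis n_gt0 : (0 < n)%N.
Hypothesis H_continuous : continuous H.
Hypothesis H_convex : strictly_convex H.
Hypothesis f_dual : forall p, SS p ->
  exists2 nu, f p = g p nu & forall nu', g p nu' <= g p nu.

Lemma has_differential_argmax (p nu : V) : SS p ->
  (forall nu', g p nu' <= g p nu) ->
  has_differential f p (pdot nu : V -> R^o).
Proof.
move=> Sp nu_max e e0.
have n0 : 0 < n%:R * 2 :> R by rewrite mulr_gt0 // ltr0n.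
have massE q : SS q -> mxdot (onev R n) q.1 = mxdot (onev R n) q.2.
  by move=> [[_ ->] [_ ->]].
have gE q u : SS q -> g q (mass_balance u) = g q u.
  by move=> Sq; rewrite /g Atr_mass_balance pdot_mass_balance // massE.
have fE q u : SS q -> (forall u', g q u' <= g q u) -> f q = g q u.
  move=> Sq u_max; have [u' -> u'_max] := f_dual Sq.
  by apply/eqP; rewrite eq_le u_max u'_max.
(* [W] is a complement of the kernel of [Atr], so strict convexity of [H] passes to [psi] there;
   [nu0] is the representative of [nu] in [W]. *)
pose W : set V := [set u | tangent u.1].
pose psi u := - g p u.
pose nu0 := mass_balance nu.
have Wconv x y (t : R) : W x -> W y -> W (t *: x + (1 - t) *: y).
  move=> Wx Wy; rewrite /W /tangent /= mxdotDr !mxdotZr.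
  by rewrite (Wx : mxdot _ _ = 0) (Wy : mxdot _ _ = 0) !mulr0 addr0.
have psic : continuous psi.
  move=> u; apply: cvgN; apply: cvgB; first exact: pdot_continuous.
  apply: (continuous_comp (f := fun u => Atr u - Theta)); last first.
    exact: H_continuous.
  by apply: cvgB; [exact: Atr_continuous | exact: cvg_cst].
have psiconv x y (t : R) : W x -> W y -> x != y -> 0 < t < 1 ->
    psi (t *: x + (1 - t) *: y) < t * psi x + (1 - t) * psi y.
  move=> Wx Wy xy t01.
  have Hxy : Atr x - Theta != Atr y - Theta.
    apply: contra_neq xy => /(addIr (- Theta)).
    exact: Atr_inj_tangent.
  have := H_convex Hxy t01.
  have -> : t *: (Atr x - Theta) + (1 - t) *: (Atr y - Theta) =
      Atr (t *: x + (1 - t) *: y) - Theta.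
    (* Adding 0 gives the second summand the shape a u + v on which [Atr_is_linear] rewrites. *)
    rewrite -[(1 - t) *: y]addr0 !Atr_is_linear linear0 addr0.
    move: (Atr x) (Atr y) => X Y.
    by apply/matrixP => i j; rewrite !mxE; ring.
  rewrite /psi /g pdotDr !pdotZr; lra.
(* Since [n%:R * 2] is the constant of [norm_pdot], this radius makes the final error at most [e]
   times the norm of [q - p]. *)
have [||||d d0 dP] := @argmin_stable R V W psi nu0 (e / (n%:R * 2)) _ _ Wconv
  _ psic psiconv.
- by rewrite divr_gt0.
- exact: PT_tangent.
- have spherec := @compact_sphere _ _ nu0 (e / (n%:R * 2)).
  apply: subclosed_compact spherec _; last by move=> x [].
  by apply: closedI; [exact: closed_tangent_fst | exact: closed_sphere].
- by move=> x Wx; rewrite /psi lerN2 /nu0 gE.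
(* This closeness bounds the functional [pdot (q - p)] by [d], as [dP] requires. *)
have : \forall q \near p, `|q - p| <= d / (n%:R * 2).
  near do rewrite distrC.
  by apply: cvgr_dist_le => //; rewrite divr_gt0.
apply: filterS => q qp Sq.
have [u _ u_max] := f_dual Sq.
have fp := fE p nu Sp nu_max.
have fq := fE q u Sq u_max.
have := u_max nu; have := nu_max u.
pose u0 := mass_balance u.
have u0nu0 : `|u0 - nu0| < e / (n%:R * 2).
  (* Subtracting [pdot (q - p)] from [psi] yields [- g q], which is minimal at [u0]. *)
  apply: (dP (pdot (q - p) : V -> R^o)).
  - move=> x; rewrite (le_trans (norm_pdot _ _)) // ler_wpM2r //.
    by rewrite mulrC -ler_pdivlMr.
  - exact: PT_tangent.
  - rewrite /psi /= !pdotBl.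
    have : g q nu0 <= g q u0 by rewrite !gE.
    rewrite /g; lra.
have qpu : pdot (q - p) u - pdot (q - p) nu = pdot (q - p) (u0 - nu0).
  by rewrite pdotBr !pdotBl !pdot_mass_balance ?massE.
have : `|pdot (q - p) (u0 - nu0)| <= e * `|q - p|.
  rewrite (le_trans (norm_pdot _ _)) // mulrAC ler_wpM2r //.
  by rewrite mulrC -ler_pdivlMr // ltW.
(* Optimality of [nu] at [p] and of [u] at [q] traps [f q - f p] between the pairings of [q - p]
   with [nu] and with [u], now known to be close. *)
rewrite -qpu fp fq /= (pdotC nu) !pdotBl !ler_norml /g.
move=> /andP[h1 h2] h3 h4; apply/andP; split; lra.
Unshelve. all: by end_near. Qed.

End dual_value.

(** * Passage from extended-real values to the real dual value function *)

Theorem theorem4p5 (R : realType) (n : nat) (hn : (0 < n)%N)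
    (Theta : 'M[R]_n) (tau : R) (htau : 0 < tau)
    (F : R -> 'M[R]_n -> \bar R)
    (Fproper : proper_fun (F tau))
    (Flsc : lower_semicontinuous (F tau))
    (Fconvex : convex_ereal (F tau))
    (Gfin : forall Y, conjugate (restrict_nonneg (F tau)) Y \is a fin_num)
    (GC1 : continuously_differentiable
             (fun Y => fine (conjugate (restrict_nonneg (F tau)) Y)))
    (Gstrict : strictly_convex
                 (fun Y => fine (conjugate (restrict_nonneg (F tau)) Y)))
    (duality : forall p, (@simplex_int R n `*` @simplex_int R n) p ->
                 strong_duality Theta (F tau) p) :
  differentiable_on_SS
    (fun p => fine (smoothed_wasserstein Theta (F tau) p)) /\
  forall p nu, (@simplex_int R n `*` @simplex_int R n) p ->
    is_argmax (dual_obj Theta (F tau) p) nu ->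
    gradient (fun q => fine (smoothed_wasserstein Theta (F tau) q)) p = PTT nu.
Proof.
set H := fun Y => fine _ in GC1 Gstrict.
have Hc : continuous H.
  by move=> Y; apply: differentiable_continuous; case: GC1.
(* Finiteness of the conjugate makes [fine] lossless, so maximality can be read in the reals. *)
have dualE q u : dual_obj Theta (F tau) q u =
    (pdot q u - H (Atr u - Theta))%:E.
  by rewrite /dual_obj /H EFinB fineK.
have argmaxE q u : is_argmax (dual_obj Theta (F tau) q) u ->
    forall u', pdot q u' - H (Atr u' - Theta) <= pdot q u - H (Atr u - Theta).
  by move=> + u' => /(_ u'); rewrite !dualE lee_fin.
set f := fun q => fine _.
have f_dual q : (@simplex_int R n `*` @simplex_int R n) q ->
    exists2 u, f q = pdot q u - H (Atr u - Theta) &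
      forall u', pdot q u' - H (Atr u' - Theta) <= pdot q u - H (Atr u - Theta).
  move=> /duality[_ [u u_max fq]]; exists u; last exact: argmaxE.
  by rewrite /f fq dualE.
have fdiff := has_differential_argmax hn Hc Gstrict f_dual.
split=> [p Sp|p nu Sp /argmaxE nu_max].
  have [u _ u_max] := f_dual p Sp.
  by exists (pdot u : _ -> R^o); exact: fdiff.
(* Uniqueness of gradients reduces the equation to checking that [PTT nu] is tangent and represents
   a differential on T x T. *)
apply: gradientE => //; split; first by split; exact: PT_tangent.
exists (pdot nu : _ -> R^o); split; first exact: fdiff.
by move=> v [v1 v2]; rewrite /pdot /= !mxdot_PT.
Qed.
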